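(* Let $n\geqslant 2$ be an integer and let $BS(1,n)\subset\mathrm{Homeo}(\mathbb{R})$ be the group generated by the maps $x\mapsto x+1$ and $x\mapsto nx$. Then $BS(1,n)$ recognizes maps with compact support; that is, for every $f\in\mathrm{Homeo}(\mathbb{R})$ with compact support and every $h\in\mathrm{Homeo}(\mathbb{R})$, if there exists a group isomorphism $\phi\colon\langle BS(1,n),f\rangle\to\langle BS(1,n),h\rangle$ with $\phi|_{BS(1,n)}=\mathrm{id}$ and $\phi(f)=h$, then $h=f$.
   Context: The support of a homeomorphism $f$ is the closure of $\{x\mid f(x)\neq x\}$. $\langle BS(1,n),f\rangle$ denotes the subgroup of $\mathrm{Homeo}(\mathbb{R})$ generated by $BS(1,n)$ and $f$. *)

(* Defs.v *)
From HB Require Import structures.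
From mathcomp Require Import all_boot all_order all_algebra.
From mathcomp Require Import all_classical all_reals all_analysis.
Import Order.TTheory GRing.Theory Num.Theory.
Import numFieldNormedType.Exports.

Set Implicit Arguments.
Unset Strict Implicit.
Unset Printing Implicit Defensive.

Local Open Scope classical_set_scope.
Local Open Scope ring_scope.

Record homeo (T : topologicalType) := Homeo {
  homeo_fun :> T -> T;
  homeo_inv : T -> T;
  homeo_funK : cancel homeo_fun homeo_inv;
  homeo_invK : cancel homeo_inv homeo_fun;
  homeo_fun_cont : continuous homeo_fun;
  homeo_inv_cont : continuous homeo_inv
}.

Section HomeoGroup.
Variable T : topologicalType.
Implicit Types f g h : homeo T.

Lemma homeo_eqP f g : (f : T -> T) =1 g -> f = g.
Proof.
case: f => f f' fK f'K cf cf'; case: g => g g' gK g'K cg cg' /= /funext fg.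
have fg' : f' = g'.
  by apply/funext => x; rewrite -{1}(g'K x) -fg fK.
subst g g'; congr Homeo; exact: Prop_irrelevance.
Qed.

HB.instance Definition _ := gen_eqMixin (homeo T).
HB.instance Definition _ := gen_choiceMixin (homeo T).

Lemma comp_homeo_cont (f g : T -> T) :
  continuous f -> continuous g -> continuous (f \o g).
Proof. by move=> cf cg x; apply: continuous_comp; [exact: cg|exact: cf]. Qed.

Lemma id_homeo_cont : continuous (id : T -> T).
Proof. by move=> x; exact: cvg_id. Qed.

Definition homeo_one : homeo T :=
  @Homeo T id id (fun=> erefl) (fun=> erefl) id_homeo_cont id_homeo_cont.

Definition homeo_mul f g : homeo T :=
  @Homeo T (f \o g) (homeo_inv g \o homeo_inv f)
    (can_comp (@homeo_funK _ f) (@homeo_funK _ g))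
    (can_comp (@homeo_invK _ g) (@homeo_invK _ f))
    (comp_homeo_cont (@homeo_fun_cont _ f) (@homeo_fun_cont _ g))
    (comp_homeo_cont (@homeo_inv_cont _ g) (@homeo_inv_cont _ f)).

Definition homeo_invg f : homeo T :=
  @Homeo T (homeo_inv f) f (@homeo_invK _ f) (@homeo_funK _ f)
    (@homeo_inv_cont _ f) (@homeo_fun_cont _ f).

Lemma homeo_mulA : associative homeo_mul.
Proof. by move=> f g h; exact: homeo_eqP. Qed.

Lemma homeo_mul1 : left_id homeo_one homeo_mul.
Proof. by move=> f; exact: homeo_eqP. Qed.

Lemma homeo_mulr1 : right_id homeo_one homeo_mul.
Proof. by move=> f; exact: homeo_eqP. Qed.

Lemma homeo_mulV : left_inverse homeo_one homeo_invg homeo_mul.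
Proof. by move=> f; apply: homeo_eqP => x; exact: homeo_funK. Qed.

Lemma homeo_mulrV : right_inverse homeo_one homeo_invg homeo_mul.
Proof. by move=> f; apply: homeo_eqP => x; exact: homeo_invK. Qed.

HB.instance Definition _ := isGroup.Build (homeo T)
  homeo_mulA homeo_mul1 homeo_mulr1 homeo_mulV homeo_mulrV.

Definition homeo_support f : set T := closure [set x | f x <> x].

End HomeoGroup.

Definition subgroup_gen (G : groupType) (A : set G) : set G :=
  smallest [set S : set G | group_closed (mem S)] A.

(* phi is total, but only its restriction to A is constrained. *)
Definition subgroup_isom (G H : groupType) (A : set G) (B : set H)
    (phi : G -> H) : Prop :=
  set_bij A B phi /\ {in A &, {morph phi : x y / (x * y)%g}}.

Section BaumslagSolitar.
Variable R : realType.

(* The generators are described by their underlying maps, which avoids carrying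
   a proof of n != 0; translation1 and dilation below show that both
   generators exist. *)
Definition BS1 (n : nat) : set (homeo R) :=
  subgroup_gen [set g : homeo R |
    (forall x : R, g x = x + 1) \/ (forall x : R, g x = n%:R * x)].

Lemma translation1 : exists g : homeo R, forall x : R, g x = x + 1.
Proof.
have c (a : R) : continuous (fun x : R => x + a).
  by move=> x; apply: cvgD; [exact: cvg_id|exact: cvg_cst].
by exists (@Homeo R _ _ (addrK 1) (subrK 1) (c 1) (c (- 1))).
Qed.

Lemma dilation (n : nat) : (0 < n)%N ->
  exists g : homeo R, forall x : R, g x = n%:R * x.
Proof.
rewrite lt0n -(pnatr_eq0 R) => n0.
have c (a : R) : continuous (fun x : R => a * x) by exact: mulrl_continuous.
by exists (@Homeo R _ _ (mulKf n0) (mulVKf n0) (c n%:R) (c n%:R^-1)).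
Qed.

Definition BS1_adjoin (n : nat) (f : homeo R) : set (homeo R) :=
  subgroup_gen (BS1 n `|` [set f]).

End BaumslagSolitar.

Arguments BS1 : clear implicits.

(* Main.v *)
Require Import Defs.
From mathcomp Require Import all_boot all_order all_algebra.
From mathcomp Require Import all_classical all_reals all_analysis.
Import numFieldNormedType.Exports.
From mathcomp Require Import ring lra.
Import Order.TTheory GRing.Theory Num.Theory.

(** Write h = phi f, with f nontrivial.  The isomorphism phi preserves and reflects commutation,
    and it commutes with conjugation by the affine maps g : x |-> c x + r of
    BS(1,n), where c can be taken small and r close to any given point.  Since
    homeomorphisms with disjoint supports commute, f commutes with g f g^-1
    whenever g carries the support of f off itself; so h commutes with
    g h g^-1 for the same g.  These relations and their iterates suffice.

    _h is increasing_ (translates_increasing).  A decreasing h has exactly one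
    fixed point p, and a far translate of h then has p + s as its only fixed
    point; two commuting maps would share it.

    _If h has a fixed point, its support is bounded_ (bounded_support).  All
    components of the complement of the fixed points of h are bounded: if
    (a, +oo) were one, h would move the endpoint of its translate (a + s, +oo),
    which it must preserve.  Now shrink one component by an affine map and place
    it, far from the origin, across an endpoint of a remote component: components
    of commuting maps cannot cross (commuting_push), so there is no remote
    component.

    _h has a fixed point_ (image_has_fixed_point).  Suppose not.  Let U be a
    small copy of f near a point that f displaces, and W = f U f^-1 U^-1, which
    is nontrivial, commutes with U and has bounded support.  A far translate of
    f commutes with f, U and W, so its image k, which has no fixed point,
    commutes with h, phi U and w = phi W.  Then w must have a fixed point
    (commutator_has_fixed_point): otherwise (w u)^N = h u^N h^-1, with
    u = phi U, would drift away from u^N without limit, whereas h stays between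
    two powers of k.  By the previous step w has bounded support, and since it
    commutes with the fixed-point-free k it is trivial, a contradiction.

    _Conclusion_ (image_eq).  Both f and h have bounded support.  If
    f y <> h y, take a copy g f g^-1 supported very near y and conjugate it by
    f: the result lives near f y, hence commutes with all small copies of f
    near h y.  On the other side the conjugate of g h g^-1 by h is nontrivial
    and lives near h y, so it fails to commute with a small enough copy of h
    placed at a point which it displaces (not_commute_displaced). *)

Set Implicit Arguments.
Unset Strict Implicit.
Unset Printing Implicit Defensive.

Local Open Scope classical_set_scope.
Local Open Scope ring_scope.

(** * Homeomorphisms as functions *)

Section HomeoPointwise.
Variable T : topologicalType.
Implicit Types (a b u v : homeo T) (x : T).

Lemma homeoM a b x : (a * b)%g x = a (b x). Proof. by []. Qed.

Lemma homeo1 x : (1%g : homeo T) x = x. Proof. by []. Qed.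

Lemma homeoKV a x : (a^-1)%g (a x) = x. Proof. exact: homeo_funK. Qed.

Lemma homeoVK a x : a ((a^-1)%g x) = x. Proof. exact: homeo_invK. Qed.

Lemma homeo_inj a : injective a.
Proof. exact: can_inj (homeoKV a). Qed.

Lemma homeoJ a b x : (a ^ b^-1)%g (b x) = b (a x).
Proof. by rewrite conjgE invgK !homeoM homeoKV. Qed.

Lemma commute_homeoP a b : commute a b <-> forall x, a (b x) = b (a x).
Proof.
split=> [ab x|ab]; first by rewrite -!homeoM ab.
by apply: homeo_eqP => x; rewrite !homeoM ab.
Qed.

Lemma commute_fixed a b x : commute a b -> b x = x -> b (a x) = a x.
Proof. by move/commute_homeoP => ab bx; rewrite -ab bx. Qed.

Lemma fixedV a x : a x = x -> (a^-1)%g x = x.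
Proof. by move=> ax; rewrite -{1}ax homeoKV. Qed.

(** If a moves x then a moves a x as well, so b fixes both; the case where b
    moves x is the same with the roles exchanged. *)
Lemma commute_disjoint a b :
  (forall x, a x <> x -> b x = x) -> commute a b.
Proof.
move=> ab; apply/commute_homeoP => x.
have [ax|ax] := pselect (a x = x).
  have [bx|bx] := pselect (b x = x); first by rewrite bx ax.
  have [->|abx] := pselect (a (b x) = b x); first by rewrite ax.
  by case: bx; apply: (homeo_inj (a := b)); exact: ab.
rewrite (ab _ ax); have [//|bax] := pselect (b (a x) = a x).
case: (ax); apply: (homeo_inj (a := a)).
by have [//|/ab] := pselect (a (a x) = a x).
Qed.

(** Conjugation by a would carry the support of v, which lies in U, outside U,
    whereas commutation forces a to preserve it. *)
Lemma not_commute_displaced a v (U : set T) :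
  (forall x, U x -> ~ U (a x)) -> (forall x, v x <> x -> U x) ->
  v <> 1%g -> ~ commute a v.
Proof.
move=> aU vU v1 av; apply: v1; apply: homeo_eqP => x.
have [//|vx] := pselect (v x = x); exfalso.
apply: (aU x); first exact: vU.
apply: vU => /(commute_fixed (commute_sym (commuteV (commute_sym av)))).
by rewrite homeoKV.
Qed.

End HomeoPointwise.

(** * Homeomorphisms of the line *)

Section HomeoLine.
Variable R : realType.
Implicit Types (g h k u v w : homeo R) (x y z c r : R).

Definition increasing u := forall x y, x < y -> u x < u y.

Lemma increasing_lt u x y : increasing u -> (u x < u y) = (x < y).
Proof.
move=> iu; have [xy|xy|->] := ltgtP x y; first by rewrite iu.
- by apply/negbTE; rewrite -leNgt ltW ?iu.
- by rewrite ltxx.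
Qed.

Lemma increasing_le u x y : increasing u -> (u x <= u y) = (x <= y).
Proof. by move=> iu; rewrite !leNgt increasing_lt. Qed.

Lemma increasing1 : increasing 1%g.
Proof. by []. Qed.

Lemma increasingM u v : increasing u -> increasing v -> increasing (u * v)%g.
Proof. by move=> iu iv x y xy; rewrite !homeoM; apply/iu/iv. Qed.

Lemma increasingV u : increasing u -> increasing u^-1%g.
Proof. by move=> iu x y xy; rewrite -(increasing_lt _ _ iu) !homeoVK. Qed.

Lemma increasingJ u v : increasing u -> increasing v -> increasing (u ^ v)%g.
Proof.
by move=> iu iv; rewrite conjgE; do !apply: increasingM => //; exact: increasingV.
Qed.

Lemma increasingX u n : increasing u -> increasing (u ^+ n)%g.
Proof.
move=> iu; elim: n => [|n IH]; first exact: increasing1.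
by rewrite expgS; apply: increasingM.
Qed.

Lemma homeo_monotone u :
  increasing u \/ (forall x y, x < y -> u y < u x).
Proof.
have cu : {within [set` `]-oo, +oo[], continuous u}.
  by apply: continuous_subspaceT; exact: homeo_fun_cont.
have [|iu|du] := itv_continuous_inj_mono cu.
- by move=> x y _ _; exact: homeo_inj.
- by left=> x y xy; apply: iu; rewrite ?in_itv.
- by right=> x y xy; apply: du; rewrite ?in_itv.
Qed.

Lemma ivt_fixed u x y : x <= u x -> u y <= y -> exists p, u p = p.
Proof.
move=> ux uy.
have cF : continuous (fun t => u t - t).
  by move=> t; apply: cvgB; [exact: homeo_fun_cont|exact: cvg_id].
suff [p _ /eqP] : exists2 p, p \in `[Num.min x y, Num.max x y] & u p - p = 0.
  by rewrite subr_eq0 => /eqP; exists p.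
apply: (@IVT R (fun t => u t - t)); first by rewrite ge_min !le_max !lexx orbT.
  exact: continuous_subspaceT.
by case: (leP x y) => _; rewrite ge_min le_max; apply/andP; split;
  apply/orP; lra.
Qed.

Lemma decreasing_fixed u :
  (forall x y, x < y -> u y < u x) -> exists p, u p = p.
Proof.
move=> du; have [u0|u0|u0] := ltgtP (u 0) 0; last by exists 0.
  by apply: (@ivt_fixed u (u 0) 0); [exact/ltW/du|exact: ltW].
by apply: (@ivt_fixed u 0 (u 0)); [exact: ltW|exact/ltW/du].
Qed.

Lemma fixed_free_sign u : (forall x, u x <> x) ->
  (forall x, x < u x) \/ (forall x, u x < x).
Proof.
move=> ufree; have [[x ux]|/forallNP up] := pselect (exists x, u x <= x).
  right=> y; rewrite ltNge; apply/negP => uy.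
  by have [p] := ivt_fixed uy ux; exact: ufree.
by left=> y; rewrite ltNge; apply/negP/up.
Qed.

Definition fixes_beyond B u := forall x, B < `|x| -> u x = x.

(** Continuity at q: the ball has at most half the radius |u q - q|, so that
    points near q are sent nearer to u q than to q. *)
Lemma displaced_ball u q e : u q <> q -> 0 < e ->
  exists2 d, 0 < d <= e &
    forall z, `|z - q| < d -> ~ (`|u z - q| < d).
Proof.
move=> uq e0; pose m := `|u q - q|.
have m0 : 0 < m by rewrite normr_gt0 subr_eq0; exact/eqP.
have /cvgrPdist_lt /(_ (m / 2)) := @homeo_fun_cont _ u q.
have m20 : 0 < m / 2 by rewrite divr_gt0.
move=> /(_ m20) /nbhs_ballP[d /= d0 ud].
exists (Num.min e (Num.min d (m / 2))).
  by rewrite !lt_min e0 d0 m20 ge_min lexx.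
move=> z; rewrite !lt_min => /and3P[_ zd _] /and3P[_ _ zm].
have := ud z; rewrite /ball /= distrC => /(_ zd) => uz.
have : m <= `|u q - u z| + `|u z - q|.
  by rewrite /m -[X in `|X|](subrKA (u z)) ler_normD.
lra.
Qed.

End HomeoLine.

(** * Commuting with a map that has no fixed point *)

Section Archimedean.
Variable R : realType.
Implicit Types (h k u v w : homeo R) (x y z : R).

(** The supremum of a bounded orbit would be a fixed point. *)
Lemma orbit_unbounded k x z : increasing k -> (forall y, y < k y) ->
  exists m, z < (k ^+ m)%g x.
Proof.
move=> ik kgt; apply/not_existsP => bd.
pose A := [set (k ^+ m)%g x | m in [set: nat]].
have supA : has_sup A.
  split; first by exists x; exists 0%N.
  by exists z => _ [m _ <-]; rewrite leNgt; apply/negP/bd.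
have /sup_adherent/(_ supA)[_ [m _ <-]] : 0 < sup A - (k^-1)%g (sup A).
  by rewrite subr_gt0 -[X in _ < X](homeoVK k) kgt.
rewrite subKr -(increasing_lt _ _ ik) homeoVK -homeoM -expgS.
rewrite ltNge => /negP; apply.
by apply: sup_upper_bound => //; exists m.+1.
Qed.

(** A power e of k brings y into the fundamental domain [0, k 0), so that a
    comparison of two maps commuting with k needs to be made only there. *)
Lemma fundamental_domain k y : increasing k -> (forall y, y < k y) ->
  exists e, [/\ increasing e, forall v, commute v k -> commute v e
    & 0 <= e y < k 0].
Proof.
move=> ik kgt; have [y0|y0] := leP 0 y.
  have kn : exists m, y < (k ^+ m)%g 0 by exact: orbit_unbounded.
  case: (ex_minnP kn) => -[|m]; first by rewrite expg0 homeo1 ltNge y0.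
  move=> ym /(_ m) /contra; rewrite -leqNgt leqnn -leNgt => /(_ isT) my.
  exists (k ^- m)%g; split.
  - exact/increasingV/increasingX.
  - by move=> v vk; apply/commuteV/commuteX.
  - have iX : increasing (k ^+ m)%g by exact: increasingX.
    rewrite -(increasing_le _ _ iX) -(increasing_lt _ (k 0) iX) homeoVK my.
    by rewrite -homeoM -expgSr.
have kn : exists m, 0 <= (k ^+ m)%g y.
  by have [m /ltW] := orbit_unbounded y 0 ik kgt; exists m.
case: (ex_minnP kn) => -[|m]; first by rewrite expg0 homeo1 leNgt y0.
move=> ym /(_ m) /contra; rewrite -leqNgt leqnn -ltNge => /(_ isT) my.
exists (k ^+ m.+1)%g; split.
- exact: increasingX.
- by move=> v vk; apply/commuteX.
- by rewrite ym expgS homeoM increasing_lt.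
Qed.

(** An estimate on the compact fundamental domain of k propagates to the whole
    line through the common centralizer. *)
Lemma dominated k v : increasing k -> increasing v ->
  (forall y, y < k y) -> commute v k ->
  exists m, forall y, v y <= (k ^+ m)%g y.
Proof.
move=> ik iv kgt vk; have [m vkm] := orbit_unbounded 0 (v (k 0)) ik kgt.
exists m => y; have [e [ie ce /andP[ey0 eyk]]] := fundamental_domain y ik kgt.
have /commute_homeoP ve := ce _ vk.
have /commute_homeoP kme := ce _ (commute_sym (commuteX m (commute_refl k))).
rewrite -(increasing_le _ _ ie) -ve -kme.
apply: le_trans (_ : v (k 0) <= _); first by rewrite increasing_le// ltW.
apply/(le_trans (ltW vkm)).
by rewrite increasing_le//; exact: increasingX.
Qed.

Lemma increasing_leX u v m : increasing u -> (forall y, u y <= v y) ->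
  forall y, (u ^+ m)%g y <= (v ^+ m)%g y.
Proof.
move=> iu uv; elim: m => [//|m IH] y; rewrite !expgS !homeoM.
by apply: le_trans (uv _); rewrite increasing_le.
Qed.

(** An Archimedean argument.  By dominated, k lies below w ^ p, while h lies below
    k ^ a and its inverse below k ^ b.  Since h u ^ N h^-1 = w ^ N u ^ N, taking
    N = p q gives k ^ q u ^ N <= k ^ (a + b) u ^ N at some point, which is
    absurd for q > a + b. *)
Lemma commutator_not_positive h k u w :
  increasing h -> increasing k -> increasing u -> increasing w ->
  (forall y, y < k y) -> (forall y, y < w y) ->
  commute h k -> commute u k -> commute w k -> commute w u ->
  (h * u = w * u * h)%g -> False.
Proof.
move=> ih ik iu iw kgt wgt hk uk wk wu e.
have [p kw] := dominated iw ik wgt (commute_sym wk).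
have [a ha] := dominated ik ih kgt hk.
have [b hb] := dominated ik (increasingV ih) kgt
  (commute_sym (commuteV (commute_sym hk))).
pose q := (a + b).+1; pose N := (p * q)%N.
have eN : (h * u ^+ N = w ^+ N * u ^+ N * h)%g.
  rewrite -expgMn//; elim: (N) => [|M IH]; first by rewrite !expg0 mulg1 mul1g.
  by rewrite !expgS mulgA e -!mulgA IH.
have /commute_homeoP ukb : commute (u ^+ N)%g (k ^+ b)%g by exact: commuteX2.
pose z := (u ^+ N)%g 0.
have lo : (k ^+ q)%g z <= (w ^+ N)%g z.
  by rewrite /N expgnA; apply: increasing_leX.
have up : (w ^+ N)%g z <= (k ^+ (a + b))%g z.
  rewrite -[z](homeoKV h) in lo *.
  have -> : (w ^+ N)%g ((h^-1)%g (h z)) = h ((u ^+ N)%g ((h^-1)%g 0)).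
    rewrite homeoKV -[RHS]homeoM eN !homeoM homeoVK //.
  rewrite homeoKV expgnDr homeoM; apply: (le_trans (ha _)).
  rewrite increasing_le; last exact: increasingX.
  by rewrite /z -ukb increasing_le//; exact: increasingX.
have := le_trans lo up; rewrite /q expgS homeoM leNgt; apply/negP/negPn/kgt.
Qed.

(** The inverse of k has the same properties as k, and inverting both u and w
    exchanges the two possible signs of a fixed-point-free w. *)
Lemma commutator_has_fixed_point h k u w :
  increasing h -> increasing k -> increasing u -> increasing w ->
  (forall y, k y <> y) ->
  commute h k -> commute u k -> commute w k -> commute w u ->
  (h * u = w * u * h)%g -> exists p, w p = p.
Proof.
move=> ih ik iu iw kfree hk uk wk wu e; apply: contrapT => /forallNP wfree.
wlog kgt : k ik kfree hk uk wk / forall y, y < k y.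
  move=> wl; have [|klt] := fixed_free_sign kfree; first exact: wl.
  apply: (wl k^-1%g); try exact: commuteV; first exact: increasingV.
    by move=> y ky; apply: (kfree y); rewrite -{1}ky homeoVK.
  by move=> y; rewrite -{1}[y](homeoVK k) klt.
have [wgt|wlt] := fixed_free_sign wfree.
  exact: (commutator_not_positive ih ik iu iw).
apply: (@commutator_not_positive h k u^-1%g w^-1%g) => //; try exact: increasingV.
- by move=> y; rewrite -{1}[y](homeoVK w) wlt.
- exact: commute_sym (commuteV (commute_sym uk)).
- exact: commute_sym (commuteV (commute_sym wk)).
- exact/commuteV/commute_sym/commuteV/commute_sym.
- rewrite -invgM -wu; apply: (mulgI (w * u)%g); apply: (mulIg u).
  by rewrite !mulgA mulgV mul1g mulgVK -e.
Qed.

End Archimedean.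

(** * Maps commuting with their affine copies *)

Section AffineCopies.
Variable R : realType.
Implicit Types (u v N : homeo R) (x y z c r s p : R).

(** The equation v = g u g^-1 for g x = c x + r, in a form that makes sense
    without mentioning the inverse of g and is stable under reflection. *)
Definition affine_copy u v c r := forall x, v (c * x + r) = c * u x + r.

(** The scale c is fixed before the precision d: a copy must be positioned with
    an error much smaller than its own size. *)
Definition commutes_with_small_copies u := exists L, forall e, 0 < e ->
  exists2 c, 0 < c < e & forall y d, L < `|y| -> 0 < d ->
    exists r v, [/\ `|r - y| < d, commute u v & affine_copy u v c r].

(** Translates in both directions are recorded to keep the condition invariant
    under the reflection of the line. *)
Definition commutes_with_translates u := exists s v w, [/\ 0 < s,
  commute u v /\ affine_copy u v 1 s & commute u w /\ affine_copy u w 1 (- s)].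

(** Conjugating by the reflection exchanges left and right; each statement about
    one side of the line below yields its mirror image this way. *)
Lemma opp_homeo : exists N : homeo R, forall x, N x = - x.
Proof.
have c : continuous (-%R : R -> R) by exact: oppr_continuous.
by exists (Homeo (@opprK R) (@opprK R) c c).
Qed.

Lemma homeoJ_opp N u x : (forall x, N x = - x) -> (u ^ N)%g x = - u (- x).
Proof.
move=> NE; rewrite conjgE !homeoM NE; apply: (homeo_inj (a := N)).
by rewrite homeoVK NE opprK.
Qed.

Lemma affine_copy_opp N u v c r : (forall x, N x = - x) ->
  affine_copy u v c r -> affine_copy (u ^ N)%g (v ^ N)%g c (- r).
Proof.
move=> NE uv x; rewrite !homeoJ_opp// opprD -mulrN opprK uv; ring.
Qed.

Lemma commute_conj u v w : commute u v -> commute (u ^ w)%g (v ^ w)%g.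
Proof. by rewrite /commute -!conjMg => ->. Qed.

Lemma small_copies_opp N u : (forall x, N x = - x) ->
  commutes_with_small_copies u -> commutes_with_small_copies (u ^ N)%g.
Proof.
move=> NE [L uL]; exists L => e /uL[c ce uc]; exists c => // y d Ly d0.
have [|//|r [v [ry uv cv]]] := uc (- y) d; first by rewrite normrN.
exists (- r), (v ^ N)%g; split; last exact: affine_copy_opp.
  by rewrite -opprD normrN -[y]opprK.
exact: commute_conj.
Qed.

Lemma translates_opp N u : (forall x, N x = - x) ->
  commutes_with_translates u -> commutes_with_translates (u ^ N)%g.
Proof.
move=> NE [s [v [w [s0 [uv cv] [uw cw]]]]].
exists s, (w ^ N)%g, (v ^ N)%g; split => //; split; try exact: commute_conj.
  by rewrite -[s]opprK; exact: affine_copy_opp.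
exact: affine_copy_opp.
Qed.

Lemma increasing_opp N u : (forall x, N x = - x) ->
  increasing u -> increasing (u ^ N)%g.
Proof. by move=> NE iu x y xy; rewrite !homeoJ_opp// ltrN2 iu// ltrN2. Qed.

Lemma last_fixed u p x : u p = p -> p <= x -> u x <> x ->
  exists a, [/\ a < x, u a = a & forall z, a < z <= x -> u z <> z].
Proof.
move=> up px ux; pose A := [set z | u z = z] `&` [set z | z <= x].
have cA : closed A.
  apply: closedI; last exact: closed_le.
  have -> : [set z | u z = z] = (fun z => u z - z) @^-1` [set 0].
    by apply/seteqP; split => z /=; [move=> ->; rewrite subrr|move/subr0_eq].
  apply: closed_comp; last exact: closed_eq.
  by move=> z _; apply: cvgB; [exact: homeo_fun_cont|exact: cvg_id].
have ubA : has_ubound A by exists x => z [].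
have A0 : A !=set0 by exists p.
have [uS Sx] : A (sup A) by apply: cA; exact: closure_sup.
exists (sup A); split => //.
  by rewrite lt_neqAle Sx andbT; apply: contra_not_neq ux => <-.
move=> z /andP[Sz zx] uz; move: Sz; rewrite ltNge => /negP; apply.
by apply: ub_le_sup => //; split.
Qed.

Lemma first_fixed u p x : u p = p -> x <= p -> u x <> x ->
  exists b, [/\ x < b, u b = b & forall z, x <= z < b -> u z <> z].
Proof.
move=> up xp ux; have [N NE] := opp_homeo.
have [|||a [ax ua aP]] := @last_fixed (u ^ N)%g (- p) (- x).
- by rewrite homeoJ_opp// opprK up.
- by rewrite lerN2.
- by rewrite homeoJ_opp// opprK => /oppr_inj.
exists (- a); split; first by rewrite ltrNr.
  by move: ua; rewrite homeoJ_opp// => /(congr1 -%R); rewrite opprK.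
move=> z /andP[xz za] uz; apply: (aP (- z)).
  by rewrite ltrNr za lerN2 xz.
by rewrite homeoJ_opp// opprK uz.
Qed.

(** The map u preserves the fixed points of v, so u c and its preimage are fixed by
    v, and one of them lies to the right of c; neither can jump over a fixed
    point of u.  Hence a component of the complement of the fixed points of v
    that starts at c cannot contain a fixed point of u or be unbounded. *)
Lemma commuting_push u v c : increasing u -> commute u v ->
  v c = c -> u c <> c ->
  exists z, [/\ c < z, v z = z & forall b, u b = b -> c < b -> z < b].
Proof.
move=> iu uv vc uc; have [lt|gt|//] := ltgtP (u c) c; last first.
  exists (u c); split => //; first exact: commute_fixed uv vc.
  by move=> b ub cb; rewrite -ub iu.
exists (u^-1%g c); split.
- by rewrite -(increasing_lt _ _ iu) homeoVK.
- exact: commute_fixed (commute_sym (commuteV (commute_sym uv))) vc.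
- by move=> b ub cb; rewrite -(increasing_lt _ _ iu) homeoVK ub.
Qed.

(** Otherwise the last fixed point a of u before x bounds a component (a, +oo);
    its right translate (a + s, +oo) is a component for a map commuting with u,
    and commuting_push produces a fixed point beyond a + s. *)
Lemma fixed_above u p x : increasing u -> commutes_with_translates u ->
  u p = p -> u x <> x -> exists2 b, x < b & u b = b.
Proof.
move=> iu [s [v [_ [s0 [uv cv] _]]]] up ux; apply: contrapT => nb.
have ufree z : x < z -> u z <> z by move=> xz uz; apply: nb; exists z.
have px : p <= x by rewrite leNgt; apply/negP => xp; exact: ufree up.
have [a [ax ua aP]] := last_fixed up px ux.
have {}aP z : a < z -> u z <> z.
  by move=> az; have [zx|/ufree//] := leP z x; apply: aP; rewrite az.
have vE z : v (z + s) = u z + s by have := cv z; rewrite !mul1r.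
have va : v (a + s) = a + s by rewrite vE ua.
have [|z [sz vz _]] := commuting_push iu uv va; first by apply: aP; lra.
apply: (aP (z - s)); first by lra.
by apply: (addIr s); rewrite -vE subrK.
Qed.

Lemma fixed_below u p x : increasing u -> commutes_with_translates u ->
  u p = p -> u x <> x -> exists2 a, a < x & u a = a.
Proof.
move=> iu tu up ux; have [N NE] := opp_homeo.
have [||b xb] := @fixed_above (u ^ N)%g (- p) (- x) (increasing_opp NE iu)
   (translates_opp NE tu).
- by rewrite homeoJ_opp// opprK up.
- by rewrite homeoJ_opp// opprK => /oppr_inj.
rewrite homeoJ_opp// => ub; exists (- b); first by rewrite ltrNl.
by rewrite -{2}ub opprK.
Qed.

(** Let (a, q] be an initial part of a component of the moved set.  If u moved
    a far point x, with b the first fixed point after x, then a copy of (a, q]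
    placed so that it starts inside (x, b) and ends after b would contradict
    commuting_push. *)
Lemma fixes_above u p : increasing u -> commutes_with_translates u ->
  commutes_with_small_copies u -> u p = p ->
  exists B, forall x, B < x -> u x = x.
Proof.
move=> iu tu [L uL] up.
have [[q uq]|/forallNP ufix] := pselect (exists q, u q <> q); last first.
  by exists 0 => x _; apply: contrapT; exact: ufix.
have [p' /ltW p'q up'] := fixed_below iu tu up uq.
have [a [aq ua aP]] := last_fixed up' p'q uq.
exists (`|L| + `|a|) => x Bx; apply: contrapT => ux.
have [p'' /ltW xp'' up''] := fixed_above iu tu up ux.
have [b [xb ub bP]] := first_fixed up'' xp'' ux.
have e0 : 0 < Num.min 1 ((b - x) / (q - a)).
  by rewrite lt_min ltr01 divr_gt0 ?subr_gt0.
have [c] := uL _ e0; rewrite lt_min => /and3P[c0 c1 cb] uc.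
rewrite ltr_pdivlMr ?subr_gt0// in cb.
(* l is the length of the copy of (a, q]; the copy will start at distance
   about l / 2 before b, whence the target b - l / 2 - c * a for r *)
set l := c * (q - a) in cb.
have l0 : 0 < l by rewrite mulr_gt0 ?subr_gt0.
have ca : c * a <= `|a|.
  apply: le_trans (ler_norm _) _; rewrite normrM (ger0_norm (ltW c0)).
  by rewrite ler_piMl ?normr_ge0 ?ltW.
have Ly : L < `|b - l / 2 - c * a|.
  have := ler_norm (b - l / 2 - c * a); have := ler_norm L; lra.
have [|r [v [ry uv cv]]] := uc (b - l / 2 - c * a) (l / 2) Ly; first by lra.
have {ry} /andP[ry1 ry2] : b - l < c * a + r < b.
  by move: ry; rewrite ltr_norml => /andP[]; lra.
have va : v (c * a + r) = c * a + r by rewrite cv ua.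
have [|z [az vz zb]] := commuting_push iu uv va.
  by apply: bP; apply/andP; split; lra.
have {}zb := zb _ ub ry2.
have zE : z = c * ((z - r) / c) + r by rewrite mulrC divfK ?gt_eqF ?subrK.
apply: (aP ((z - r) / c)).
  rewrite ltr_pdivlMr// ler_pdivrMr//; move: ry1; rewrite /l; lra.
have cne : c != 0 by rewrite gt_eqF.
by apply: (mulfI cne); apply: (addIr r); rewrite -cv -zE.
Qed.

Lemma bounded_support u p : increasing u -> commutes_with_translates u ->
  commutes_with_small_copies u -> u p = p -> exists B, fixes_beyond B u.
Proof.
move=> iu tu su up; have [N NE] := opp_homeo.
have [B uB] := fixes_above iu tu su up.
have [|B' uB'] := @fixes_above (u ^ N)%g (- p) (increasing_opp NE iu)
  (translates_opp NE tu) (small_copies_opp NE su).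
  by rewrite homeoJ_opp// opprK up.
exists (Num.max B B') => x; rewrite gt_max => /andP[Bx B'x].
have [x0|x0] := leP 0 x; first by apply: uB; rewrite ger0_norm in Bx.
have := uB' (- x); rewrite homeoJ_opp// opprK; rewrite ltr0_norm// in B'x.
by move=> /(_ B'x)/oppr_inj.
Qed.

End AffineCopies.

(** * Bounded supports and affine conjugates *)

Section BoundedSupport.
Variable R : realType.
Implicit Types (F u v k g : homeo R) (x y z c r B : R).

(** A decreasing u has a unique fixed point p, and the translate of u has the
    fixed point p + s; commutation forces u to fix p + s too. *)
Lemma translates_increasing u : commutes_with_translates u -> increasing u.
Proof.
move=> [s [v [_ [s0 [uv cv] _]]]].
have [//|du] := homeo_monotone u; have [p up] := decreasing_fixed du.
have uniq y : u y = y -> y = p.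
  move=> uy; have [yp|py|//] := ltgtP y p.
    by have := du _ _ yp; rewrite uy up ltNge (ltW yp).
  by have := du _ _ py; rewrite uy up ltNge (ltW py).
have vE x : v (x + s) = u x + s by have := cv x; rewrite !mul1r.
have vps : v (p + s) = p + s by rewrite vE up.
have : u (u (p + s) - s) = u (p + s) - s.
  by apply: (addIr s); rewrite -vE subrK; exact: commute_fixed uv vps.
move=> /uniq/eqP; rewrite subr_eq => /eqP/uniq; lra.
Qed.

Lemma fixes_beyond_le B B' u : B <= B' -> fixes_beyond B u -> fixes_beyond B' u.
Proof. by move=> BB' uB x xB; apply: uB; exact: le_lt_trans xB. Qed.

Lemma fixes_beyondM B u v :
  fixes_beyond B u -> fixes_beyond B v -> fixes_beyond B (u * v)%g.
Proof. by move=> uB vB x xB; rewrite homeoM vB// uB. Qed.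

Lemma fixes_beyondV B u : fixes_beyond B u -> fixes_beyond B u^-1%g.
Proof. by move=> uB x xB; apply/fixedV/uB. Qed.

Lemma compact_support_bounded u :
  compact (homeo_support u) -> exists2 B, 0 < B & fixes_beyond B u.
Proof.
move=> /compact_bounded[M [_ uM]]; exists (`|M| + 1); first by rewrite ltr_wpDl.
move=> x Mx; apply: contrapT => ux; move: Mx; rewrite ltNge => /negP; apply.
apply: (uM (`|M| + 1)); first by rewrite (le_lt_trans (ler_norm _))// ltrDl.
exact: subset_closure.
Qed.

Definition affine g c r := forall x, g x = c * x + r.

Lemma conj_affine_copy u g c r :
  affine g c r -> affine_copy u (u ^ g^-1)%g c r.
Proof. by move=> gE x; rewrite -!gE homeoJ. Qed.

Lemma conj_moved B u g c r x : affine g c r -> 0 < c -> fixes_beyond B u ->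
  (u ^ g^-1)%g x <> x -> `|x - r| <= c * B.
Proof.
move=> gE c0 uB; rewrite -[x](homeoVK g) homeoJ => gux.
set y := (g^-1)%g x in gux *; rewrite gE addrK normrM gtr0_norm// ler_pM2l//.
by rewrite leNgt; apply/negP => /uB uy; rewrite uy in gux.
Qed.

Lemma far_conj_commute B u v g c r : affine g c r -> 0 < c <= 1 ->
  2 * B < `|r| -> fixes_beyond B u -> fixes_beyond B v ->
  commute u (v ^ g^-1)%g.
Proof.
move=> gE /andP[c0 c1] rB uB vB; apply: commute_disjoint => x ux.
apply: contrapT => /(conj_moved gE c0 vB) xr.
have {ux} xB : `|x| <= B by rewrite leNgt; apply/negP => /uB.
have B0 : 0 <= B by exact: le_trans xB.
have : `|r| <= `|x| + `|x - r| by rewrite -[X in `|X|](subKr x) ler_normB.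
have : c * B <= B by rewrite ler_piMl.
lra.
Qed.

(** A point moved by u is carried by the powers of k to moved points arbitrarily
    far away. *)
Lemma commute_free_bounded B u k : increasing k -> (forall x, k x <> x) ->
  commute u k -> fixes_beyond B u -> u = 1%g.
Proof.
move=> ik kfree uk uB.
wlog kgt : k ik kfree uk / forall x, x < k x.
  move=> wl; have [|klt] := fixed_free_sign kfree; first exact: wl.
  apply: (wl k^-1%g); [exact: increasingV| |exact: commuteV|].
    by move=> x kx; apply: (kfree x); rewrite -{1}kx homeoVK.
  by move=> x; rewrite -{1}[x](homeoVK k) klt.
apply: homeo_eqP => x; have [m Bm] := orbit_unbounded x B ik kgt.
apply: (homeo_inj (a := (k ^+ m)%g)).
have /commute_homeoP <- : commute u (k ^+ m)%g by exact: commuteX.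
by apply: uB; rewrite (lt_le_trans Bm)// ler_norm.
Qed.

End BoundedSupport.

(** * Affine elements of the Baumslag-Solitar group *)

Section GeneratedSubgroup.
Variables (G : groupType) (A : set G).

Lemma subgroup_gen_sub x : A x -> subgroup_gen A x.
Proof. by move=> Ax S [_]; apply. Qed.

Lemma subgroup_gen1 : subgroup_gen A 1%g.
Proof. by move=> S [[S1 _] _]; rewrite inE in S1. Qed.

Lemma subgroup_genV x : subgroup_gen A x -> subgroup_gen A x^-1%g.
Proof.
move=> Ax S SA; have := Ax S SA; case: SA => /group_closedV SV _ Sx.
by have := SV x; rewrite !inE; apply.
Qed.

Lemma subgroup_genM x y :
  subgroup_gen A x -> subgroup_gen A y -> subgroup_gen A (x * y)%g.
Proof.
move=> Ax Ay S SA; have := Ay S SA; have := Ax S SA.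
case: SA => /group_closedM SM _ Sx Sy.
by have := SM x y; rewrite !inE; apply.
Qed.

Lemma subgroup_genX x m : subgroup_gen A x -> subgroup_gen A (x ^+ m)%g.
Proof.
move=> Ax; elim: m => [|m IH]; first exact: subgroup_gen1.
by rewrite expgS; exact: subgroup_genM.
Qed.

End GeneratedSubgroup.

Section AffineElements.
Variables (R : realType) (n : nat).
Hypothesis n_ge2 : (2 <= n)%N.
Implicit Types (g : homeo R) (c r y d e : R).

Lemma affineM g g' c c' r r' : affine g c r -> affine g' c' r' ->
  affine (g * g')%g (c * c') (c * r' + r).
Proof. by move=> gE gE' x; rewrite homeoM gE gE'; ring. Qed.

Lemma affineV g c r : c != 0 -> affine g c r ->
  affine g^-1%g c^-1 (- (c^-1 * r)).
Proof.
move=> c0 gE x; apply: (homeo_inj (a := g)); rewrite homeoVK gE.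
by field.
Qed.

Lemma BS1_translation m : exists2 g, BS1 R n g & affine g 1 m%:R.
Proof.
have [t tE] := translation1 R; exists (t ^+ m)%g.
  by apply: subgroup_genX; exact: subgroup_gen_sub (or_introl tE).
elim: m => [|m IH] x; first by rewrite expg0 homeo1; ring.
by rewrite expgS homeoM tE IH -natr1; ring.
Qed.

Lemma BS1_int_translation (m : int) : exists2 g, BS1 R n g & affine g 1 m%:~R.
Proof.
case: m => m; first exact: BS1_translation.
have [t Bt tE] := BS1_translation m.+1; exists t^-1%g.
  exact: subgroup_genV.
move=> x; rewrite (affineV (oner_neq0 _) tE) invr1 mul1r NegzE mulrNz //.
Qed.

Lemma BS1_contraction m : exists2 g, BS1 R n g & affine g (n%:R ^- m) 0.
Proof.
have n0 : (n%:R : R) != 0 by rewrite pnatr_eq0 -lt0n (ltn_trans _ n_ge2).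
have [|t tE] := @dilation R n; first exact: ltn_trans n_ge2.
have tmE : affine (t ^+ m)%g (n%:R ^+ m) 0.
  elim: m => [|m IH] x; first by rewrite expg0 homeo1; ring.
  by rewrite expgS homeoM tE IH exprS; ring.
exists (t ^- m)%g.
  apply: subgroup_genV; apply: subgroup_genX.
  exact: subgroup_gen_sub (or_intror tE).
by move=> x; rewrite (affineV _ tmE) ?expf_neq0//; ring.
Qed.

Lemma small_power e : 0 < e -> exists m, (n%:R : R) ^- m < e.
Proof.
move=> e0; pose m := Num.truncn e^-1; exists m.+1.
have n0 : (0 : R) < n%:R by rewrite ltr0n (ltn_trans _ n_ge2).
rewrite -[ltRHS]invrK ltf_pV2 ?posrE ?exprn_gt0 ?invr_gt0//.
apply: (lt_le_trans (truncnS_gt _)); rewrite -natrX ler_nat.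
by apply/ltnW/ltn_expl.
Qed.

(** The conjugate of an integer translation by a high power of the dilation is a
    translation by an arbitrary n-adic rational; compose it with a contraction. *)
Lemma BS1_affine_dense e : 0 < e -> exists2 c, 0 < c < e & forall y d, 0 < d ->
  exists g r, [/\ BS1 R n g, affine g c r & `|r - y| < d].
Proof.
have n0 : (0 : R) < n%:R by rewrite ltr0n (ltn_trans _ n_ge2).
move=> /small_power[i ie]; exists (n%:R ^- i).
  by rewrite ie invr_gt0 exprn_gt0.
move=> y d /small_power[j jd].
have [a Ba aE] := BS1_contraction i.
have [b Bb bE] := BS1_contraction j.
have [t Bt tE] := BS1_int_translation (Num.floor (y * n%:R ^+ j)).
have q0 : 0 < (n%:R : R) ^+ j by rewrite exprn_gt0.
exists (b * t * b^-1 * a)%g, (n%:R ^- j * (Num.floor (y * n%:R ^+ j))%:~R).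
split.
- by do !apply: subgroup_genM => //; exact: subgroup_genV.
- have qne : (n%:R : R) ^- j != 0 by rewrite invr_neq0 ?gt_eqF.
  move=> x; rewrite (affineM (affineM (affineM bE tE) (affineV qne bE)) aE).
  rewrite mulr1 divff//; ring.
apply: le_lt_trans jd.
set q := n%:R ^+ j in q0 *; set z := Num.floor _.
have /andP[zl zr] := real_floor_itv (num_real (y * q)).
have -> : y = q^-1 * (y * q) by rewrite mulrCA mulVf ?mulr1 ?gt_eqF.
rewrite -mulrBr normrM gtr0_norm ?invr_gt0// ler_piMr ?invr_ge0 ?(ltW q0)//.
rewrite ler_norml; move: zl zr; rewrite -/z intrD; lra.
Qed.

End AffineElements.

(** * Isomorphisms that are the identity on the Baumslag-Solitar group *)

Section Rigidity.
Variables (R : realType) (n : nat) (G : set (homeo R)).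
Variable phi : homeo R -> homeo R.
Hypothesis n_ge2 : (2 <= n)%N.
Hypothesis G_closed : group_closed (mem G).
Hypothesis BS1_G : BS1 R n `<=` G.
Hypothesis phiM : {in G &, {morph phi : x y / (x * y)%g}}.
Hypothesis phi_inj : {in G &, injective phi}.
Hypothesis phi_BS1 : forall g, BS1 R n g -> phi g = g.
Implicit Types (a b u v w k g F : homeo R) (x y z c r B : R).

Lemma GM a b : G a -> G b -> G (a * b)%g.
Proof.
move=> Ga Gb; have := group_closedM G_closed; move=> /(_ a b).
by rewrite !inE; apply.
Qed.

Lemma GV a : G a -> G a^-1%g.
Proof.
by move=> Ga; have := group_closedV G_closed; move=> /(_ a); rewrite !inE; apply.
Qed.

Lemma GJ a g : G a -> BS1 R n g -> G (a ^ g)%g.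
Proof.
by move=> Ga /BS1_G Gg; rewrite conjgE; do ?apply: GM => //; exact: GV.
Qed.

Lemma phi_mul a b : G a -> G b -> phi (a * b)%g = (phi a * phi b)%g.
Proof. by move=> Ga Gb; apply: phiM; rewrite inE. Qed.

Lemma phi_one : phi 1%g = 1%g.
Proof. by apply: phi_BS1; exact: subgroup_gen1. Qed.

Lemma phi_inv a : G a -> phi a^-1%g = (phi a)^-1%g.
Proof.
move=> Ga; apply/esym/mulg1_eq; rewrite -phi_mul//; last exact: GV.
by rewrite mulgV phi_one.
Qed.

Lemma phi_conj a g : G a -> BS1 R n g -> phi (a ^ g)%g = (phi a ^ g)%g.
Proof.
move=> Ga Bg; have Gg := BS1_G Bg.
by rewrite !conjgE !phi_mul ?phi_inv ?(phi_BS1 Bg)//; do ?[exact: GV|exact: GM].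
Qed.

Lemma phi_commute a b : G a -> G b -> commute (phi a) (phi b) <-> commute a b.
Proof.
move=> Ga Gb; rewrite /commute -!phi_mul//; split => [|->//].
by move=> e; exact: (phi_inj (mem_set (GM Ga Gb)) (mem_set (GM Gb Ga)) e).
Qed.

Lemma phi_eq1 a : G a -> phi a = 1%g -> a = 1%g.
Proof.
move=> Ga; rewrite -[in X in X -> _]phi_one => e.
have G1 : G 1%g by apply: BS1_G; exact: subgroup_gen1.
exact: (phi_inj (mem_set Ga) (mem_set G1) e).
Qed.

(** The supports of u and of the conjugate of v are disjoint, so these two
    elements commute, and phi transports the relation even though nothing is
    known about the supports of the images. *)
Lemma image_far_commute B u v g c r : G u -> G v -> BS1 R n g ->
  affine g c r -> 0 < c <= 1 -> 2 * B < `|r| ->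
  fixes_beyond B u -> fixes_beyond B v -> commute (phi u) (phi v ^ g^-1)%g.
Proof.
move=> Gu Gv Bg gE c01 rB uB vB.
have BgV : BS1 R n g^-1%g by exact: subgroup_genV.
rewrite -phi_conj//; apply/phi_commute => //; first exact: GJ.
exact: far_conj_commute gE c01 rB uB vB.
Qed.

Lemma BS1_far_translation B : exists g s,
  [/\ BS1 R n g, affine g 1 s & B < s /\ 0 < s].
Proof.
pose m := (Num.truncn `|B|).+1; have [g Bg gE] := BS1_translation R n m.
exists g, m%:R; split => //; split; last by rewrite ltr0n.
by apply: (le_lt_trans (ler_norm B)); exact: truncnS_gt.
Qed.

Lemma image_translates B u :
  G u -> fixes_beyond B u -> commutes_with_translates (phi u).
Proof.
move=> Gu uB; have [g [s [Bg gE [sB s0]]]] := BS1_far_translation (2 * B).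
have gVE : affine g^-1%g 1 (- s).
  by move=> x; rewrite (affineV (oner_neq0 _) gE) invr1 mul1r.
have BgV : BS1 R n g^-1%g by exact: subgroup_genV.
exists s, (phi u ^ g^-1)%g, (phi u ^ (g^-1)^-1)%g; split => //; split.
- by apply: (image_far_commute Gu Gu Bg gE _ _ uB uB);
    rewrite ?ltr01 ?lexx ?gtr0_norm.
- exact: conj_affine_copy.
- by apply: (image_far_commute Gu Gu BgV gVE _ _ uB uB);
    rewrite ?ltr01 ?lexx ?normrN ?gtr0_norm.
- exact: conj_affine_copy.
Qed.

Lemma image_increasing B u : G u -> fixes_beyond B u -> increasing (phi u).
Proof. by move=> Gu uB; exact: translates_increasing (image_translates Gu uB). Qed.

Lemma image_small_copies B u :
  G u -> fixes_beyond B u -> commutes_with_small_copies (phi u).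
Proof.
move=> Gu uB; exists (2 * B + 1) => e e0.
have [|c] := BS1_affine_dense n_ge2 (e := Num.min e 1).
  by rewrite lt_min e0 ltr01.
rewrite lt_min => /and3P[c0 ce c1] dense; exists c; first by rewrite c0.
move=> y d By d0; have [|g [r [Bg gE ry]]] := dense y (Num.min d 1).
  by rewrite lt_min d0 ltr01.
move: ry; rewrite lt_min => /andP[rd r1].
exists r, (phi u ^ g^-1)%g; split => //; last exact: conj_affine_copy.
apply: (image_far_commute Gu Gu Bg gE _ _ uB uB); first by rewrite c0 ltW.
have : `|y| <= `|r| + `|r - y| by rewrite -[X in `|X|](subKr r) ler_normB.
lra.
Qed.

Lemma image_bounded B u p : G u -> fixes_beyond B u -> phi u p = p ->
  exists B', fixes_beyond B' (phi u).
Proof.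
move=> Gu uB; apply: bounded_support.
- exact: image_increasing uB.
- exact: image_translates uB.
- exact: image_small_copies uB.
Qed.

(** One affine map works for all maps supported in [- B, B]: in the proof of
    image_eq it is applied to an element and to its image together. *)
Lemma BS1_shrink B y d : 0 < B -> 0 < d -> exists g, BS1 R n g /\
  forall u x, fixes_beyond B u -> (u ^ g^-1)%g x <> x -> `|x - y| < d.
Proof.
move=> B0 d0; have [|c /andP[c0 ce] dense] :=
  BS1_affine_dense n_ge2 (e := d / 2 / B); first by rewrite !divr_gt0.
have [|g [r [Bg gE ry]]] := dense y (d / 2); first by rewrite divr_gt0.
exists g; split => // u x uB /(conj_moved gE c0 uB) xr.
rewrite ltr_pdivlMr// in ce.
have : `|x - y| <= `|x - r| + `|r - y| by rewrite ler_distD.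
lra.
Qed.

(** If phi f had no fixed point, the commutator W of f with a small copy of
    itself would have an image w with a fixed point, hence with bounded support;
    being centralized by a translate of phi f, which has no fixed point, w would
    be trivial, but W is not. *)
Lemma image_has_fixed_point B f : G f -> 0 < B -> fixes_beyond B f ->
  f <> 1%g -> exists p, phi f p = p.
Proof.
move=> Gf B0 fB f1; apply: contrapT => /forallNP hfree.
have [q fq] : exists q, f q <> q.
  by apply/existsNP => fid; apply: f1; exact: homeo_eqP.
have [d /andP[d0 d1] dP] := displaced_ball fq ltr01.
have [g [Bg gP]] := BS1_shrink q B0 d0.
have BgV : BS1 R n g^-1%g by exact: subgroup_genV.
pose U := (f ^ g^-1)%g; pose V := (U ^ f^-1)%g; pose W := (V * U^-1)%g.
have GU : G U by exact: GJ.
have GV' : G V by rewrite /V conjgE invgK; apply: GM => //; apply: GM => //; exact: GV.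
have GW : G W by apply: GM => //; exact: GV.
have U1 : U <> 1%g by move=> /eqP; rewrite conjg_eq1 => /eqP.
have nfU : ~ commute f U.
  by apply: not_commute_displaced U1; [exact: dP|move=> x; exact: gP].
have W1 : W <> 1%g.
  move=> /divg1_eq; rewrite /V conjgE invgK => VU; apply: nfU.
  by rewrite /commute -[in RHS]VU -!mulgA mulVg mulg1.
have VU : commute V U.
  apply: commute_disjoint => x; rewrite -[x](homeoVK f) homeoJ => VUx.
  apply: contrapT => /(gP _ _ fB) xq.
  apply: (dP (f^-1%g x)) => //; apply: (gP f) => // Ux.
  by apply: VUx; rewrite Ux.
(* B' bounds the supports of both f and U *)
pose B' := Num.max B (`|q| + d).
have fB' : fixes_beyond B' f.
  by apply: fixes_beyond_le fB; rewrite le_max lexx.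
have UB' : fixes_beyond B' U.
  move=> x; rewrite gt_max => /andP[_ xq]; apply: contrapT => /(gP _ _ fB) Ux.
  have : `|x| <= `|x - q| + `|q| by rewrite -{1}(subrK q x) ler_normD.
  lra.
have WB' : fixes_beyond B' W.
  apply: fixes_beyondM (fixes_beyondV UB'); rewrite /V conjgE invgK.
  exact: fixes_beyondM fB' (fixes_beyondM UB' (fixes_beyondV fB')).
have [t [s [Bt tE [sB s0]]]] := BS1_far_translation (2 * B').
have BtV : BS1 R n t^-1%g by exact: subgroup_genV.
(* a translate of f by more than 2 B' has support disjoint from those of f, U
   and W; k is its image *)
pose k := (phi f ^ t^-1)%g.
have far u : G u -> fixes_beyond B' u -> commute (phi u) k.
  move=> Gu uB; apply: (image_far_commute Gu Gf Bt tE _ _ uB fB').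
    by rewrite ltr01 lexx.
  by rewrite gtr0_norm.
have kfree x : k x <> x.
  rewrite -[x](homeoVK t) homeoJ => /homeo_inj; exact: hfree.
have ih := image_increasing Gf fB.
have it : increasing t by move=> x y xy; rewrite !tE; lra.
have ik : increasing k by apply: increasingJ => //; exact: increasingV.
have [|||||||p wp] := @commutator_has_fixed_point R (phi f) k (phi U) (phi W)
    ih ik _ _ kfree.
- exact: image_increasing UB'.
- exact: image_increasing WB'.
- exact: far.
- exact: far.
- exact: far.
- apply/phi_commute => //; apply: commute_sym; apply: commuteM.
    exact: commute_sym.
  by apply: commuteV.
- rewrite -!phi_mul//; last by apply: GM.
  by rewrite /W mulgVK /V conjgE invgK -!mulgA mulVg mulg1.
have [B3 wB3] := image_bounded GW WB' wp.
apply: W1; apply: (phi_eq1 GW).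
exact: commute_free_bounded ik kfree (far _ GW WB') wB3.
Qed.

(** The commutation of P = f (g f g^-1) f^-1 with the small copies of f detects the
    position of its support, hence the value of f at the point y where g
    concentrates; and Q = phi P is built from h in the same way. *)
Lemma image_eq f B : G f -> 0 < B -> fixes_beyond B f -> phi f = f.
Proof.
move=> Gf B0' fB0.
have [->|/eqP f1] := eqVneq f 1%g; first exact: phi_one.
have [p hp] := image_has_fixed_point Gf B0' fB0 f1.
have [B1 hB1] := image_bounded Gf fB0 hp.
pose B' := Num.max B B1.
have B'0 : 0 < B' by rewrite lt_max B0'.
have fB : fixes_beyond B' f by apply: fixes_beyond_le fB0; rewrite le_max lexx.
have hB : fixes_beyond B' (phi f).
  by apply: fixes_beyond_le hB1; rewrite le_max lexx orbT.
set h := phi f in hp hB hB1 *.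
have h1 : h <> 1%g by move=> /(phi_eq1 Gf).
apply: homeo_eqP => y; apply: contrapT => hfy.
(* points within m of h y are at least m away from f y *)
pose m := `|h y - f y| / 2.
have m0 : 0 < m by rewrite divr_gt0// normr_gt0 subr_eq0; exact/eqP.
have near u : exists2 d, 0 < d & forall x, `|x - y| < d -> `|u x - u y| < m.
  have /cvgrPdist_lt /(_ m m0) /nbhs_ballP[d /= d0 ud] := @homeo_fun_cont _ u y.
  exists d => // x xy; rewrite distrC; apply: ud.
  by rewrite /ball /= distrC.
have [d1 d10 fd] := near f; have [d2 d20 hd] := near h.
have [|g [Bg gP]] := BS1_shrink y B'0 (d := Num.min d1 d2).
  by rewrite lt_min d10.
have BgV : BS1 R n g^-1%g by exact: subgroup_genV.
pose P := ((f ^ g^-1) ^ f^-1)%g; pose Q := ((h ^ g^-1) ^ h^-1)%g.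
have Gfg : G (f ^ g^-1)%g by exact: GJ.
have GfV : G f^-1%g by exact: GV.
have GP : G P by rewrite /P conjgE invgK; apply: GM => //; exact: GM.
have QE : phi P = Q.
  rewrite /P /Q (conjgE _ f^-1%g) (conjgE _ h^-1%g) !invgK.
  rewrite (phi_mul Gf) ?(phi_mul Gfg GfV) ?phi_conj ?phi_inv//.
  exact: GM.
have moved u x : fixes_beyond B' u ->
    ((u ^ g^-1) ^ u^-1)%g x <> x -> `|(u^-1)%g x - y| < Num.min d1 d2.
  move=> uB; rewrite -{1 2}[x](homeoVK u) homeoJ => ux.
  by apply: (gP u) => // e; apply: ux; rewrite e.
have Pm x : P x <> x -> `|x - f y| < m.
  move=> /(moved _ _ fB); rewrite lt_min => /andP[/fd + _].
  by rewrite homeoVK.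
have Qm x : Q x <> x -> `|x - h y| < m.
  move=> /(moved _ _ hB); rewrite lt_min => /andP[_ /hd].
  by rewrite homeoVK.
have [q Qq] : exists q, Q q <> q.
  apply/existsNP => Qid; have /eqP : Q = 1%g by exact: homeo_eqP.
  by rewrite /Q !conjg_eq1 => /eqP.
have qm := Qm _ Qq; rewrite -subr_gt0 in qm.
have [d3 /andP[d30 d3m] dP] := displaced_ball Qq qm.
have [g' [Bg' g'P]] := BS1_shrink q B'0 d30.
have Bg'V : BS1 R n g'^-1%g by exact: subgroup_genV.
have Gf' : G (f ^ g'^-1)%g by exact: GJ.
apply: (not_commute_displaced dP (v := (h ^ g'^-1)%g)).
- by move=> x; exact: g'P.
- by move=> /eqP; rewrite conjg_eq1 => /eqP.
rewrite -QE -phi_conj//; apply/phi_commute => //.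
apply: commute_disjoint => x /Pm xf; apply: contrapT => /(g'P _ _ fB) xq.
have : `|h y - f y| <= `|h y - q| + `|q - f y| by rewrite ler_distD.
have : `|q - f y| <= `|q - x| + `|x - f y| by rewrite ler_distD.
have mE : `|h y - f y| = 2 * m by rewrite /m; field.
rewrite (distrC (h y) q) (distrC q x) mE; lra.
Qed.

End Rigidity.

Theorem theorem1p3 (R : realType) (n : nat) (n_ge2 : (2 <= n)%N)
    (f : homeo R) (f_compact : compact (homeo_support f)) (h : homeo R) :
  (exists phi : homeo R -> homeo R,
     [/\ subgroup_isom (BS1_adjoin n f) (BS1_adjoin n h) phi,
         forall g : homeo R, BS1 R n g -> phi g = g
       & phi f = h]) ->
  h = f.
Proof.
move=> [phi [[[_ phi_inj _] phiM] phi_BS1 <-]].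
have [B B0 fB] := compact_support_bounded f_compact.
apply: (image_eq n_ge2 _ _ phiM phi_inj phi_BS1 _ B0 fB).
- split=> [|u v]; rewrite !inE; first exact: subgroup_gen1.
  by move=> Gu Gv; apply: subgroup_genM => //; exact: subgroup_genV.
- by move=> g Bg; apply: subgroup_gen_sub; left.
- by apply: subgroup_gen_sub; right.
Qed.
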